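(* Let $A$ be a cluster algebra with extended exchange matrix $\tilde B$, and let $(\tilde B,\Lambda,W)$ be a compatible triple such that $(\tilde B,W)$ is also a compatible pair. Let $A_q$ and $A'_p$ be the quantum cluster algebras quantizing $A$ determined by the compatible pairs $(\tilde B,\Lambda)$ and $(\tilde B,W)$ respectively ($A'_p$ is the dual quantum cluster algebra of $A_q$), and let $a$ be a nonzero integer such that $(\tilde B,W,a\Lambda)$ is a compatible triple. Let $A_{p,q}$ be the secondly quantized cluster algebra of $A_q$ given by the triple $(\tilde B,\Lambda,W)$ and $A'_{q,p}$ the secondly quantized cluster algebra of $A'_p$ given by the triple $(\tilde B,W,a\Lambda)$. Then $A_{p,q}$ and $A'_{q,p}$ are essentially the same, in the sense that there is a cluster isomorphism (a ring isomorphism) $$\psi:\ A_{p,q}\otimes_{\mathbb Z[q^{\pm\frac12}]}\mathbb Z[q^{\pm\frac1{2a}}]\longrightarrow A'_{q,p}$$ which fixes the variables (sends each cluster or frozen variable $Y_t^{e_i}$ of the first algebra to the corresponding variable $Y_t^{e_i}$ of the second) and sends $p$ to $q$ and $q$ to $p^a$.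
   Context: Notation: $[1,m]=\{1,\dots,m\}$; $[a]_+=\max\{a,0\}$, componentwise on vectors. $n\le m$. Compatible pairs. $\tilde B=(b_{ij})$ is an $m\times n$ integer matrix whose top $n\times n$ part $B$ is skew-symmetrizable ($DB$ skew-symmetric for a positive diagonal $D$). A skew-symmetric integer $m\times m$ matrix $\Lambda$ forms a compatible pair with $\tilde B$ if $\tilde B^\top\Lambda=(D\ \ O)$ with $D$ a skew-symmetrizer. Mutation $\mu_k$, $k\in[1,n]$: $b'_{ij}=-b_{ij}$ if $i=k$ or $j=k$, and $b'_{ij}=b_{ij}+\mathrm{sgn}(b_{ik})[b_{ik}b_{kj}]_+$ otherwise; a skew-symmetric matrix $R$ (here $R=\Lambda$ or $W$) mutates to the skew-symmetric $R'$ with $R'_{kj}=-R_{kj}+\sum_{l}[b_{lk}]_+R_{lj}$ for $j\ne k$ and $R'_{ij}=R_{ij}$ for $i,j\ne k$. The cluster algebra $A$ is the ordinary (commutative) cluster algebra with exchange matrix $\tilde B$ and inverted frozen variables; the quantum cluster algebra attached to a compatible pair $(\tilde B,\Lambda)$ is the Berenstein–Zelevinsky quantum cluster algebra with quasi-commutation $X^{e_i}X^{e_j}=q^{\frac12\lambda_{ij}}X^{e_i+e_j}$ at the initial seed (with parameter called $p$ for $A'_p$). Compatible triples. $(\tilde B,\Lambda,W)$, with $W$ an $m\times m$ skew-symmetric integer matrix, is compatible if $(\tilde B,\Lambda)$ is a compatible pair and every triple obtained from it by iterated mutation satisfies, for all $j\in[1,m]$, $k\in[1,n]$, $k\ne j$: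 (C2) if $b_{uk}\ne0$ then $W_{uj}\lambda_{kj}=W_{kj}\lambda_{uj}$; (C3) if $b_{uk}b_{vk}\ne0$ then $W_{uj}\lambda_{vj}=W_{vj}\lambda_{uj}$; (C4) $\sum_{t:\lambda_{tj}=0}W_{tj}b_{tk}=0$. Secondly quantized cluster algebra. For a compatible triple $(\tilde B,\Lambda,W)$ and commuting central parameters $p,q$, the $(p,q)$-quantum torus is the $\mathbb Z[p^{\pm1/2},q^{\pm1/2}]$-algebra with basis $Y^e$ ($e\in\mathbb Z^m$) and product $Y^eY^f=p^{\frac12e^\top Wf}q^{\frac12e^\top\Lambda f}Y^{e+f}$, with skew-field of fractions $\mathcal F_{p,q}$. Mutation of the extended cluster $(Y^{e_1},\dots,Y^{e_m})$ in direction $k\in[1,n]$ replaces $Y^{e_k}$ by $Y^{-e_k+[b_k]_+}+Y^{-e_k+[-b_k]_+}$ ($b_k$ the $k$-th column of $\tilde B$) and replaces $\tilde B,\Lambda,W$ by $\tilde B',\Lambda',W'$, where $b'_{ij}=-b_{ij}$ if $i=k$ or $j=k$ and $b'_{ij}=b_{ij}+\mathrm{sgn}(b_{ik})[b_{ik}b_{kj}]_+$ otherwise, and where, for $R=\Lambda$ and $R=W$, $R'$ is the skew-symmetric matrix with $R'_{kj}=-R_{kj}+\sum_{l}[b_{lk}]_+R_{lj}$ for $j\ne k$ and $R'_{ij}=R_{ij}$ for $i,j\ne k$; the resulting extended cluster at vertex $t$ of the $n$-regular tree is $(Y_t^{e_1},\dots,Y_t^{e_n},Y^{e_{n+1}},\dots,Y^{e_m})$.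 The secondly quantized cluster algebra (second quantization) $A_{p,q}$ of $A_q$ is the $\mathbb Z[p^{\pm1/2},q^{\pm1/2}][Y^{\pm e_{n+1}},\dots,Y^{\pm e_m}]$-subalgebra of $\mathcal F_{p,q}$ generated by all $Y_t^{e_i}$, $i\in[1,n]$. Likewise $A'_{q,p}$ is built from the triple $(\tilde B,W,a\Lambda)$ with product $Y^eY^f=q^{\frac12e^\top Wf}p^{\frac12e^\top(a\Lambda)f}Y^{e+f}$. *)

(* Defs.v *)
From HB Require Import structures.
From mathcomp Require Import all_boot all_order all_algebra.
From mathcomp Require Import finmap boolp.
From mathcomp.multinomials Require Import monalg.

Set Implicit Arguments.
Unset Strict Implicit.
Unset Printing Implicit Defensive.

Import GRing.Theory Num.Theory.

Local Open Scope fset_scope.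
Local Open Scope ring_scope.

(* A monoid together with a normalised 2-cocycle with values in R. The library
   algebra structure on {malg R[K]} is restricted to monoids whose only unit
   is 1 (monomType), hence the separate construction.                             *)
Record twist (R : comNzRingType) := Twist {
  tw_sort :> choiceType;
  tw_mul : tw_sort -> tw_sort -> tw_sort;
  tw_one : tw_sort;
  tw_coef : tw_sort -> tw_sort -> R;
  tw_mulA : associative tw_mul;
  tw_mul1k : left_id tw_one tw_mul;
  tw_mulk1 : right_id tw_one tw_mul;
  tw_coefA : forall x y z,
    tw_coef x y * tw_coef (tw_mul x y) z = tw_coef y z * tw_coef x (tw_mul y z);
  tw_coef1k : forall x, tw_coef tw_one x = 1;
  tw_coefk1 : forall x, tw_coef x tw_one = 1
}.

Definition twalg (R : comNzRingType) (D : twist R) : Type := {malg R[D]}.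

Fact tw_key : unit. Proof. by []. Qed.

Section TwistedAlgebra.
Variables (R : comNzRingType) (D : twist R).
Implicit Types (g : {malg R[D]}) (k : D).

Definition twone : {malg R[D]} := << 1 *g tw_one D >>.

Definition twmul : {malg R[D]} -> {malg R[D]} -> {malg R[D]} :=
  locked_with tw_key (fun g1 g2 =>
    \sum_(k1 <- msupp g1) \sum_(k2 <- msupp g2)
      << g1@_k1 * g2@_k2 * tw_coef k1 k2 *g tw_mul k1 k2 >>).

Lemma twmulE g1 g2 : twmul g1 g2 =
  \sum_(k1 <- msupp g1) \sum_(k2 <- msupp g2)
    << g1@_k1 * g2@_k2 * tw_coef k1 k2 *g tw_mul k1 k2 >>.
Proof. by rewrite /twmul locked_withE. Qed.

Lemma twmulw (d1 d2 : {fset D}) g1 g2 :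
  msupp g1 `<=` d1 -> msupp g2 `<=` d2 ->
  twmul g1 g2 = \sum_(k1 <- d1) \sum_(k2 <- d2)
    << g1@_k1 * g2@_k2 * tw_coef k1 k2 *g tw_mul k1 k2 >>.
Proof.
move=> le_d1 le_d2; rewrite twmulE (big_fset_incl _ le_d1) /=.
  apply/eq_bigr=> k1 _; apply/big_fset_incl => // k _ /mcoeff_outdom ->.
  by rewrite mulr0 mul0r monalgU0.
move=> k _ /mcoeff_outdom g1k.
by rewrite big1 => // k' _; rewrite g1k !mul0r monalgU0.
Qed.

Lemma twmulDl : left_distributive twmul +%R.
Proof.
move=> g1 g2 g; have le2 := fsubset_refl (msupp g).
rewrite (twmulw (fsubsetUl (msupp g1) (msupp g2)) le2).
rewrite (twmulw (fsubsetUr (msupp g1) (msupp g2)) le2).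
rewrite (twmulw (msuppD_le g1 g2) le2).
rewrite -big_split; apply/eq_bigr=> k1 _ /=.
rewrite -big_split; apply/eq_bigr=> k2 _ /=.
by rewrite mcoeffD !mulrDl monalgUD.
Qed.

Lemma twmulDr : right_distributive twmul +%R.
Proof.
move=> g g1 g2; have le2 := fsubset_refl (msupp g).
rewrite (twmulw le2 (fsubsetUl (msupp g1) (msupp g2))).
rewrite (twmulw le2 (fsubsetUr (msupp g1) (msupp g2))).
rewrite (twmulw le2 (msuppD_le g1 g2)).
rewrite -big_split; apply/eq_bigr=> k1 _ /=.
rewrite -big_split; apply/eq_bigr=> k2 _ /=.
by rewrite mcoeffD mulrDr mulrDl monalgUD.
Qed.

Lemma twmul0g : left_zero 0 twmul.
Proof. by move=> g; rewrite twmulE msupp0 big_seq_fset0. Qed.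

Lemma twmulg0 : right_zero 0 twmul.
Proof.
by move=> g; rewrite twmulE msupp0 big1 // => k _; rewrite big_seq_fset0.
Qed.

Lemma twmulUU c1 c2 k1 k2 :
  twmul << c1 *g k1 >> << c2 *g k2 >> =
  << c1 * c2 * tw_coef k1 k2 *g tw_mul k1 k2 >>.
Proof. by rewrite (twmulw msuppU_le msuppU_le) !big_seq_fset1 !mcoeffUU. Qed.

Lemma twmul_suml (I : Type) (r : seq I) (F : I -> {malg R[D]}) g :
  twmul (\sum_(i <- r) F i) g = \sum_(i <- r) twmul (F i) g.
Proof. exact: (big_morph (twmul^~ g) (fun x y => twmulDl x y g) (twmul0g g)). Qed.

Lemma twmul_sumr (I : Type) (r : seq I) (F : I -> {malg R[D]}) g :
  twmul g (\sum_(i <- r) F i) = \sum_(i <- r) twmul g (F i).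
Proof. exact: (big_morph (twmul g) (twmulDr g) (twmulg0 g)). Qed.

Lemma twmul1g : left_id twone twmul.
Proof.
move=> g; rewrite [g in LHS]monalgE [RHS]monalgE twmul_sumr.
by apply/eq_bigr=> k _; rewrite twmulUU tw_coef1k tw_mul1k mul1r mulr1.
Qed.

Lemma twmulg1 : right_id twone twmul.
Proof.
move=> g; rewrite [g in LHS]monalgE [RHS]monalgE twmul_suml.
by apply/eq_bigr=> k _; rewrite twmulUU tw_coefk1 tw_mulk1 !mulr1.
Qed.

Lemma twmulA : associative twmul.
Proof.
move=> g1 g2 g3; rewrite [g1]monalgE !twmul_suml; apply/eq_bigr=> k1 _.
rewrite [g2]monalgE twmul_suml !twmul_sumr twmul_suml; apply/eq_bigr=> k2 _.
rewrite [g3]monalgE !twmul_sumr.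
apply/eq_bigr=> k3 _; rewrite !twmulUU tw_mulA; congr << _ *g _ >>.
set c1 := g1@_k1; set c2 := g2@_k2; set c3 := g3@_k3.
rewrite -!mulrA; do 2 congr (_ * _).
by rewrite -tw_coefA mulrCA.
Qed.

Lemma twone_neq0 : twone != 0.
Proof. by rewrite monalgU_eq0 oner_eq0. Qed.

HB.instance Definition _ := GRing.Lmodule.on (twalg D).
HB.instance Definition _ := GRing.Zmodule_isNzRing.Build (twalg D)
  twmulA twmul1g twmulg1 twmulDl twmulDr twone_neq0.

Lemma twmulZl c (x y : twalg D) : c *: (x * y) = (c *: x) * y.
Proof.
have mulE (u v : twalg D) : u * v = twmul u v by [].
rewrite !mulE (twmulw (msuppZ_le _ _) (fsubset_refl _)) twmulE scaler_sumr.
apply/eq_bigr=> k1 _; rewrite scaler_sumr; apply/eq_bigr=> k2 _.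
by apply/malgP=> k; rewrite mcoeffZ !mcoeffU -mulrnAr mcoeffZ !mulrnAr !mulrA.
Qed.

Lemma twmulZr c (x y : twalg D) : c *: (x * y) = x * (c *: y).
Proof.
have mulE (u v : twalg D) : u * v = twmul u v by [].
rewrite !mulE (twmulw (fsubset_refl _) (msuppZ_le _ _)) twmulE scaler_sumr.
apply/eq_bigr=> k1 _; rewrite scaler_sumr; apply/eq_bigr=> k2 _.
apply/malgP=> k; rewrite mcoeffZ !mcoeffU -mulrnAr mcoeffZ !mulrnAr !mulrA.
by rewrite (mulrC c).
Qed.

HB.instance Definition _ := GRing.Lmodule_isLalgebra.Build R (twalg D) twmulZl.
HB.instance Definition _ := GRing.Lalgebra_isAlgebra.Build R (twalg D) twmulZr.

Definition twmon : D -> twalg D := locked_with tw_key (fun k => << 1 *g k >>).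

Lemma twmonE k : twmon k = << 1 *g k >>.
Proof. by rewrite /twmon locked_withE. Qed.

Lemma twmon1 : twmon (tw_one D) = 1.
Proof. exact: twmonE. Qed.

Lemma twmonM k1 k2 :
  twmon k1 * twmon k2 = tw_coef k1 k2 *: twmon (tw_mul k1 k2).
Proof.
have mulE (x y : twalg D) : x * y = twmul x y by [].
rewrite mulE !twmonE twmulUU; apply/malgP=> k.
by rewrite mcoeffZ !mcoeffU mulrnAr !mulr1 mul1r.
Qed.

End TwistedAlgebra.

(* The group ring of the additive group V; lmon v is the Laurent monomial with
   exponent v, so V := int and V := int * int give the Laurent polynomial rings
   over the integers in one and in two variables.                            *)
Section Laurent.
Variable V : zmodType.

Fact laurent_twist_subproof (x y z : V) : 1 * 1 = 1 * 1 :> int.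
Proof. by []. Qed.

Definition laurent_twist : twist int :=
  @Twist int V +%R 0 (fun _ _ => 1) (@addrA V) (@add0r V) (@addr0 V)
    laurent_twist_subproof (fun _ => erefl) (fun _ => erefl).

Definition laurent : Type := twalg laurent_twist.

HB.instance Definition _ := GRing.Algebra.on laurent.

Fact laurent_mulC : commutative (@GRing.mul laurent).
Proof.
move=> x y; have mulE (u v : laurent) : u * v = twmul u v by [].
rewrite !mulE [in LHS]twmulE exchange_big twmulE; apply/eq_bigr=> k2 _; apply/eq_bigr=> k1 _.
by rewrite [x@_k1 * _]mulrC [tw_mul k1 k2]addrC.
Qed.

HB.instance Definition _ := GRing.PzRing_hasCommutativeMul.Build laurent
  laurent_mulC.

Definition lmon (v : V) : laurent := twmon (v : laurent_twist).

Lemma lmonD v w : lmon (v + w) = lmon v * lmon w.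
Proof. by rewrite [RHS]twmonM scale1r. Qed.

Lemma lmon0 : lmon 0 = 1.
Proof. exact: (twmon1 laurent_twist). Qed.

End Laurent.

Record expo (V : zmodType) (S : nzRingType) := Expo {
  expo_fun :> V -> S;
  expo0 : expo_fun 0 = 1;
  expoD : forall v w, expo_fun (v + w) = expo_fun v * expo_fun w
}.

Section LaurentEval.
Variables (V : zmodType) (S : nzRingType) (chi : expo V S).

Definition laurent_eval (x : laurent V) : S :=
  \sum_(k <- msupp x) chi k *~ x@_k.

Lemma laurent_evalw (d : {fset V}) (x : laurent V) : msupp x `<=` d ->
  laurent_eval x = \sum_(k <- d) chi k *~ x@_k.
Proof.
move=> le; rewrite /laurent_eval (big_fset_incl _ le) //= => k _.
by move/mcoeff_outdom=> ->.
Qed.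

Lemma laurent_evalU c v : laurent_eval << c *g v >> = chi v *~ c.
Proof. by rewrite (laurent_evalw msuppU_le) big_seq_fset1 mcoeffUU. Qed.

Fact laurent_eval_is_zmod_morphism : zmod_morphism laurent_eval.
Proof.
move=> x y; set d := msupp x `|` msupp y.
rewrite (@laurent_evalw d) ?msuppB_le // (@laurent_evalw d x) ?fsubsetUl //.
rewrite (@laurent_evalw d y) ?fsubsetUr // -sumrB.
by apply/eq_bigr=> k _; rewrite mcoeffB mulrzBr.
Qed.

HB.instance Definition _ := GRing.isZmodMorphism.Build (laurent V) S
  laurent_eval laurent_eval_is_zmod_morphism.

Fact laurent_eval_is_monoid_morphism : monoid_morphism laurent_eval.
Proof.
split=> [|x y]; first by rewrite laurent_evalU expo0.
have -> : x * y = twmul x y by [].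
rewrite twmulE raddf_sum /= {2}/laurent_eval mulr_suml; apply/eq_bigr=> k1 _.
rewrite raddf_sum /= /laurent_eval mulr_sumr; apply/eq_bigr=> k2 _.
rewrite -/(laurent_eval _) laurent_evalU expoD mulr1.
by rewrite mulrzAl mulrzAr -mulrzA mulrC.
Qed.

HB.instance Definition _ := GRing.isMonoidMorphism.Build (laurent V) S
  laurent_eval laurent_eval_is_monoid_morphism.

End LaurentEval.

(* The Laurent ring in p^(1/2) and q^(1/2); pq i j stands for p^(i/2) q^(j/2). *)
Definition pq_ring : Type := laurent (int * int)%type.
HB.instance Definition _ := GRing.ComNzRing.on pq_ring.

Definition pq (i j : int) : pq_ring := lmon (i, j).

Lemma pqM i j i' j' : pq i j * pq i' j' = pq (i + i') (j + j').
Proof. exact/esym/(@lmonD _ (i, j) (i', j')). Qed.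

Lemma pq00 : pq 0 0 = 1.
Proof. exact: lmon0. Qed.

Section QuantumTorus.
Variable m : nat.

Definition bform (R : 'M[int]_m) (e f : 'cV[int]_m) : int :=
  (e^T *m R *m f) 0 0.

Lemma bformDl R e e' f : bform R (e + e') f = bform R e f + bform R e' f.
Proof. by rewrite /bform linearD /= !mulmxDl mxE. Qed.

Lemma bformDr R e f f' : bform R e (f + f') = bform R e f + bform R e f'.
Proof. by rewrite /bform mulmxDr mxE. Qed.

Lemma bform0l R f : bform R 0 f = 0.
Proof. by rewrite /bform trmx0 !mul0mx mxE. Qed.

Lemma bform0r R e : bform R e 0 = 0.
Proof. by rewrite /bform mulmx0 mxE. Qed.

Variables L W : 'M[int]_m.

Definition torus_coef (e f : 'cV[int]_m) : pq_ring :=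
  pq (bform W e f) (bform L e f).

Fact torus_coefA e f g :
  torus_coef e f * torus_coef (e + f) g = torus_coef f g * torus_coef e (f + g).
Proof.
rewrite /torus_coef !pqM !bformDl !bformDr.
have AC (x y z : int) : x + (y + z) = z + (x + y) by rewrite addrA addrC.
exact: (congr2 pq (AC _ _ _) (AC _ _ _)).
Qed.

Fact torus_coef0l e : torus_coef 0 e = 1.
Proof. by rewrite /torus_coef !bform0l pq00. Qed.

Fact torus_coef0r e : torus_coef e 0 = 1.
Proof. by rewrite /torus_coef !bform0r pq00. Qed.

Definition torus_twist : twist pq_ring :=
  @Twist pq_ring 'cV[int]_m +%R 0 torus_coef
    (@addrA _) (@add0r _) (@addr0 _) torus_coefA torus_coef0l torus_coef0r.

(* The algebra over pq_ring with basis (torusY e), e in Z^m, and product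
     Y^e Y^f = p^(e^T W f / 2) q^(e^T L f / 2) Y^(e + f).                    *)
Definition qtorus : Type := twalg torus_twist.
HB.instance Definition _ := GRing.Algebra.on qtorus.

Definition torusY (e : 'cV[int]_m) : qtorus := twmon (e : torus_twist).

Lemma torusYM e f :
  torusY e * torusY f = pq (bform W e f) (bform L e f) *: torusY (e + f).
Proof. exact: (@twmonM _ torus_twist). Qed.

End QuantumTorus.

(* Skew-fields of (right) fractions of T. They are unique up to a unique
   isomorphism over T, and exist when T is an Ore domain, for instance when T is
   a quantum torus.                                                          *)
Record skew_fractions (T : nzRingType) := SkewFractions {
  frac_sort :> unitRingType;
  frac_emb : {rmorphism T -> frac_sort};
  frac_emb_inj : injective frac_emb;
  frac_unit : forall x : frac_sort, x != 0 -> x \is a GRing.unit;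
  frac_surj : forall x : frac_sort,
    exists u v : T, v != 0 /\ x = frac_emb u / frac_emb v
}.

Section GeneratedSubring.
Variables (F : nzRingType) (G : F -> Prop).

Definition gen_subring : {pred F} := fun x =>
  `[< forall S : {pred F},
        subring_closed S -> (forall g, G g -> g \in S) -> x \in S >].

Lemma gen_subringP x : reflect
  (forall S : {pred F},
     subring_closed S -> (forall g, G g -> g \in S) -> x \in S)
  (x \in gen_subring).
Proof. exact: asboolP. Qed.

Lemma mem_gen_subring g : G g -> g \in gen_subring.
Proof. by move=> Gg; apply/gen_subringP=> S _; apply. Qed.

Fact gen_subring_closed : subring_closed gen_subring.
Proof.
split=> [|x y /gen_subringP xS /gen_subringP yS
         |x y /gen_subringP xS /gen_subringP yS];
  apply/gen_subringP=> S clS GS; case: (clS) => S1 SB SM //.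
- by apply: SB; [exact: xS | exact: yS].
- by apply: SM; [exact: xS | exact: yS].
Qed.

HB.instance Definition _ := GRing.isSubringClosed.Build F gen_subring
  gen_subring_closed.

Definition gen_ring : Type := {x : F | x \in gen_subring}.

HB.instance Definition _ := SubChoice.on gen_ring.
HB.instance Definition _ := [SubChoice_isSubNzRing of gen_ring by <:].

Definition gen_elt (x : F) (Gx : G x) : gen_ring := Sub x (mem_gen_subring Gx).

End GeneratedSubring.

(* A (x)_R B, for two R-algebras given by their structure morphisms (with
   central images) f and g, is the quotient of the monoid ring of the
   multiplicative monoid A * B by the bilinearity and balancedness relations.
   When f and g have central images the additive subgroup spanned by the
   relators is already a two-sided ideal, so that the additive group of the
   quotient is the usual tensor product of modules.                          *)
Section Tensor.
Variables (R A B : nzRingType).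
Variables (f : {rmorphism R -> A}) (g : {rmorphism R -> B}).

Fact pair_twist_coef (x y z : A * B) : 1 * 1 = 1 * 1 :> int.
Proof. by []. Qed.

Definition pair_mul (x y : A * B) : A * B := (x.1 * y.1, x.2 * y.2).

Fact pair_mulA : associative pair_mul.
Proof. by move=> x y z; rewrite /pair_mul !mulrA. Qed.

Fact pair_mul1k : left_id (1, 1) pair_mul.
Proof. by case=> a b; rewrite /pair_mul !mul1r. Qed.

Fact pair_mulk1 : right_id (1, 1) pair_mul.
Proof. by case=> a b; rewrite /pair_mul !mulr1. Qed.

Definition pair_twist : twist int :=
  @Twist int (A * B)%type pair_mul (1, 1) (fun _ _ => 1)
    pair_mulA pair_mul1k pair_mulk1 pair_twist_coef
    (fun _ => erefl) (fun _ => erefl).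

Definition pair_ring : Type := twalg pair_twist.
HB.instance Definition _ := GRing.NzRing.on pair_ring.

Definition pair_gen (a : A) (b : B) : pair_ring :=
  twmon ((a, b) : pair_twist).

Variant tensor_relator : pair_ring -> Prop :=
| TensorDl a a' b :
    tensor_relator (pair_gen (a + a') b - pair_gen a b - pair_gen a' b)
| TensorDr a b b' :
    tensor_relator (pair_gen a (b + b') - pair_gen a b - pair_gen a b')
| TensorZ a r b :
    tensor_relator (pair_gen (a * f r) b - pair_gen a (g r * b)).

Definition ideal_closed (I : {pred pair_ring}) : Prop :=
  [/\ zmod_closed I, forall x u, u \in I -> x * u \in I
    & forall x u, u \in I -> u * x \in I].

Definition tensor_ideal : {pred pair_ring} := fun x =>
  `[< forall I : {pred pair_ring},
        ideal_closed I -> (forall u, tensor_relator u -> u \in I) -> x \in I >].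

Lemma tensor_idealP x : reflect
  (forall I : {pred pair_ring},
     ideal_closed I -> (forall u, tensor_relator u -> u \in I) -> x \in I)
  (x \in tensor_ideal).
Proof. exact: asboolP. Qed.

Fact tensor_ideal_zmod_closed : zmod_closed tensor_ideal.
Proof.
split=> [|x y /tensor_idealP xI /tensor_idealP yI].
  by apply/tensor_idealP=> I [[]].
apply/tensor_idealP=> I clI relI; case: (clI) => [[_ IB] _ _].
by apply: IB; [exact: xI | exact: yI].
Qed.

Fact tensor_idealMl x u : u \in tensor_ideal -> x * u \in tensor_ideal.
Proof.
move/tensor_idealP=> uI; apply/tensor_idealP=> I clI relI.
by case: (clI) => [_ IM _]; apply: IM; exact: uI.
Qed.

Fact tensor_idealMr x u : u \in tensor_ideal -> u * x \in tensor_ideal.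
Proof.
move/tensor_idealP=> uI; apply/tensor_idealP=> I clI relI.
by case: (clI) => [_ _ IM]; apply: IM; exact: uI.
Qed.

HB.instance Definition _ := GRing.isZmodClosed.Build pair_ring tensor_ideal
  tensor_ideal_zmod_closed.

Local Open Scope quotient_scope.

Definition tensor : Type := Quotient.quot tensor_ideal.

HB.instance Definition _ := EqQuotient.on tensor.
HB.instance Definition _ := GRing.Zmodule.on tensor.
HB.instance Definition _ := ZmodQuotient.on tensor.

Definition tensor_pi (x : pair_ring) : tensor := \pi_tensor x.

Lemma tensor_piE x y : tensor_pi x = tensor_pi y <-> x - y \in tensor_ideal.
Proof. by rewrite Quotient.idealrBE; split=> [/eqP|/eqP]. Qed.

Definition tensor_mul (x y : tensor) : tensor := tensor_pi (repr x * repr y).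

Lemma tensor_mulE x y :
  tensor_mul (tensor_pi x) (tensor_pi y) = tensor_pi (x * y).
Proof.
apply/tensor_piE; set x' := repr _; set y' := repr _.
have xI : x' - x \in tensor_ideal by apply/tensor_piE/reprK.
have yI : y' - y \in tensor_ideal by apply/tensor_piE/reprK.
have -> : x' * y' - x * y = (x' - x) * y' + x * (y' - y).
  by rewrite mulrBl mulrBr addrA subrK.
exact: rpredD (tensor_idealMr _ xI) (tensor_idealMl _ yI).
Qed.

Lemma tensor_piK x : tensor_pi (repr x) = x.
Proof. exact: reprK. Qed.

Lemma tensor_piD x y : tensor_pi (x + y) = tensor_pi x + tensor_pi y.
Proof. exact: (raddfD (\pi_tensor)). Qed.

Fact tensor_mulA : associative tensor_mul.
Proof.
move=> x y z; rewrite -[x]tensor_piK -[y]tensor_piK -[z]tensor_piK.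
by rewrite !tensor_mulE mulrA.
Qed.

Fact tensor_mul1x : left_id (tensor_pi 1) tensor_mul.
Proof. by move=> x; rewrite -[x]tensor_piK tensor_mulE mul1r. Qed.

Fact tensor_mulx1 : right_id (tensor_pi 1) tensor_mul.
Proof. by move=> x; rewrite -[x]tensor_piK tensor_mulE mulr1. Qed.

Fact tensor_mulDl : left_distributive tensor_mul +%R.
Proof.
move=> x y z; rewrite -[x]tensor_piK -[y]tensor_piK -[z]tensor_piK.
by rewrite -tensor_piD !tensor_mulE mulrDl tensor_piD.
Qed.

Fact tensor_mulDr : right_distributive tensor_mul +%R.
Proof.
move=> x y z; rewrite -[x]tensor_piK -[y]tensor_piK -[z]tensor_piK.
by rewrite -tensor_piD !tensor_mulE mulrDr tensor_piD.
Qed.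

HB.instance Definition _ := GRing.Zmodule_isPzRing.Build tensor
  tensor_mulA tensor_mul1x tensor_mulx1 tensor_mulDl tensor_mulDr.

Definition tens (a : A) (b : B) : tensor := tensor_pi (pair_gen a b).

End Tensor.

(* Indices range over 'I_(n + r), the first n being mutable and the last r
   frozen (so the usual m >= n is n + r); lshift r k is the mutable index k.   *)

Definition skew_symmetric (m : nat) (R : 'M[int]_m) : Prop := R^T = - R.

Definition skew_symmetrizer (n : nat) (d : 'rV[int]_n) (B : 'M[int]_n) : Prop :=
  (forall j, 0 < d 0 j) /\ skew_symmetric (diag_mx d *m B).

Definition compatible_pair (n r : nat)
    (B : 'M[int]_(n + r, n)) (L : 'M[int]_(n + r)) : Prop :=
  skew_symmetric L /\
  exists d : 'rV[int]_n,
    skew_symmetrizer d (usubmx B) /\ B^T *m L = row_mx (diag_mx d) 0.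

Record triple (n r : nat) := Triple {
  tB : 'M[int]_(n + r, n);
  tL : 'M[int]_(n + r);
  tW : 'M[int]_(n + r)
}.

Section Mutation.
Variables (n r : nat) (k : 'I_n).

Definition mutate_exchange (B : 'M[int]_(n + r, n)) : 'M[int]_(n + r, n) :=
  \matrix_(i, j)
    if (i == lshift r k) || (j == k) then - B i j
    else B i j + Num.sg (B i k) * Num.max (B i k * B (lshift r k) j) 0.

Definition mutate_form (B : 'M[int]_(n + r, n)) (R : 'M[int]_(n + r)) :
    'M[int]_(n + r) :=
  let row j := - R (lshift r k) j + \sum_l Num.max (B l k) 0 * R l j in
  \matrix_(i, j)
    if i == lshift r k then (if j == lshift r k then 0 else row j)
    else if j == lshift r k then - row i else R i j.

Definition mutate_triple (T : triple n r) : triple n r :=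
  Triple (mutate_exchange (tB T))
    (mutate_form (tB T) (tL T)) (mutate_form (tB T) (tW T)).

End Mutation.

Section CompatibleTriple.
Variables n r : nat.

Definition triple_conditions (T : triple n r) : Prop :=
  let: Triple B L W := T in
  forall (j : 'I_(n + r)) (k : 'I_n), lshift r k != j ->
  [/\ forall u, B u k != 0 ->
        W u j * L (lshift r k) j = W (lshift r k) j * L u j,
      forall u v, B u k * B v k != 0 -> W u j * L v j = W v j * L u j
    & \sum_(t | L t j == 0) W t j * B t k = 0].

Definition compatible_triple (B : 'M[int]_(n + r, n)) (L W : 'M[int]_(n + r)) :
    Prop :=
  [/\ compatible_pair B L, skew_symmetric W
    & forall s : seq 'I_n,
        triple_conditions (foldl (fun T k => mutate_triple k T)
                             (Triple B L W) s)].

End CompatibleTriple.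

(* The vertices of the n-regular tree with edges labelled by 'I_n, each encoded
   by the sequence of labels of the geodesic leading to it from the initial
   vertex.                                                                   *)
Definition tree_vertex (n : nat) : Type :=
  {t : seq 'I_n | sorted (fun k l => k != l) t}.

Section SecondQuantization.
Variables (n r : nat).
Variables (B : 'M[int]_(n + r, n)) (L W : 'M[int]_(n + r)).
Variable F : skew_fractions (qtorus L W).

Definition basis_vec (i : 'I_(n + r)) : 'cV[int]_(n + r) := delta_mx i 0.

Definition pos_col (C : 'M[int]_(n + r, n)) (k : 'I_n) : 'cV[int]_(n + r) :=
  \col_i Num.max (C i k) 0.

Definition scal (c : pq_ring) : F := frac_emb F c%:A.

Record seed := Seed {
  seed_var : 'I_(n + r) -> F;
  seed_triple : triple n r
}.

(* The element Y_t^e of the quantum torus generated by the extended cluster of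
   a seed: the relation Y^e Y^f = p^(e^T W f / 2) q^(e^T L f / 2) Y^(e + f)
   gives
     Y_1^(e_1) ... Y_m^(e_m) =
       p^(sum_(i < j) e_i e_j W_ij / 2) q^(sum_(i < j) e_i e_j L_ij / 2) Y^e. *)
Definition seed_monomial (s : seed) (e : 'cV[int]_(n + r)) : F :=
  let ordering_exponent (R : 'M[int]_(n + r)) : int :=
    \sum_(i : 'I_(n + r)) \sum_(j : 'I_(n + r) | (i < j)%N) e i 0 * e j 0 * R i j in
  scal (pq (- ordering_exponent (tW (seed_triple s)))
           (- ordering_exponent (tL (seed_triple s))))
  * \prod_i seed_var s i ^ e i 0.

Definition initial_seed : seed :=
  Seed (fun i => frac_emb F (torusY L W (basis_vec i))) (Triple B L W).

Definition mutate_seed (s : seed) (k : 'I_n) : seed :=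
  let C := tB (seed_triple s) in
  Seed
    (fun i => if i == lshift r k then
        seed_monomial s (- basis_vec (lshift r k) + pos_col C k)
        + seed_monomial s (- basis_vec (lshift r k) + pos_col (- C) k)
      else seed_var s i)
    (mutate_triple k (seed_triple s)).

Definition seed_at (t : tree_vertex n) : seed :=
  foldl mutate_seed initial_seed (val t).

Variant sq_generator : F -> Prop :=
| GenScal c : sq_generator (scal c)
| GenFrozen (j : 'I_r) :
    sq_generator (frac_emb F (torusY L W (basis_vec (rshift n j))))
| GenFrozenV (j : 'I_r) :
    sq_generator (frac_emb F (torusY L W (- basis_vec (rshift n j))))
| GenCluster t (i : 'I_n) : sq_generator (seed_var (seed_at t) (lshift r i)).

(* The algebra A_{p,q}. The scalars and the Y^(+-e_j) with j frozen generate
   the coefficient ring Z[p^(+-1/2), q^(+-1/2)][Y^(+-e_(n+1)),...,Y^(+-e_m)]. *)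
Definition second_quantization : Type := gen_ring sq_generator.
HB.instance Definition _ := GRing.NzRing.on second_quantization.

Definition sq_scal (c : pq_ring) : second_quantization :=
  gen_elt (GenScal c).

Definition sq_frozen (j : 'I_r) : second_quantization :=
  gen_elt (GenFrozen j).

Definition sq_cluster (t : tree_vertex n) (i : 'I_n) : second_quantization :=
  gen_elt (GenCluster t i).

Fact sq_scal1 : sq_scal 1 = 1.
Proof. by apply: val_inj; rewrite /= /scal scale1r rmorph1. Qed.

Fact sq_scalM c d : sq_scal (c * d) = sq_scal c * sq_scal d.
Proof.
by apply: val_inj; rewrite /= /scal -rmorphM -scalerAl mul1r scalerA.
Qed.

Fact sq_scal_central c x : sq_scal c * x = x * sq_scal c.
Proof.
apply: val_inj; rewrite /= /scal; have [u [v [_ ->]]] := frac_surj (val x).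
have comm w : GRing.comm (frac_emb F c%:A) (frac_emb F w).
  by rewrite /GRing.comm -!rmorphM -scalerAl -scalerAr mul1r mulr1.
exact: commrM (comm u) (commrV (comm v)).
Qed.

Fact q_expo0 : sq_scal (pq 0 0) = 1.
Proof. by rewrite pq00 sq_scal1. Qed.

Fact q_expoD v w : sq_scal (pq 0 (v + w)) = sq_scal (pq 0 v) * sq_scal (pq 0 w).
Proof. by rewrite -sq_scalM pqM. Qed.

Definition q_expo : expo int second_quantization := Expo q_expo0 q_expoD.

Section ExtendedScalars.
Variable a : int.

Fact root_expo0 : lmon (a * 0) = 1 :> laurent int.
Proof. by rewrite mulr0 lmon0. Qed.

Fact root_expoD v w : lmon (a * (v + w)) = lmon (a * v) * lmon (a * w).
Proof. by rewrite mulrDr lmonD. Qed.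

Definition root_expo : expo int (laurent int) := Expo root_expo0 root_expoD.

(* A_{p,q} (x)_{Z[q^(+-1/2)]} Z[q^(+-1/(2a))]: the variable of the base ring
   laurent int is q^(1/2), that of the right-hand factor laurent int is
   q^(1/(2a)), and q^(1/2) acts on the latter as its a-th power.             *)
Definition sq_extension : Type :=
  tensor (laurent_eval q_expo) (laurent_eval root_expo).
HB.instance Definition _ := GRing.PzRing.on sq_extension.

Definition sq_tens (x : second_quantization) (y : laurent int) : sq_extension :=
  tens (laurent_eval q_expo) (laurent_eval root_expo) x y.

End ExtendedScalars.

End SecondQuantization.

Arguments sq_scal {n r} B {L W} F c.
Arguments sq_frozen {n r} B {L W} F j.
Arguments sq_cluster {n r} B {L W} F t i.
Arguments sq_extension {n r} B {L W} F a.
Arguments sq_tens {n r} B {L W} F a x y.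

(* Main.v *)
(* The twist p -> q, q -> p^a of the scalars, with Y^e fixed, is an embedding
   of quantum tori, hence extends to the skew-fields of right fractions. Since
   mutation of Lambda and W is linear for a fixed exchange matrix, it sends
   every seed of (B, Lambda, W) to the corresponding seed of (B, W, a Lambda),
   and so restricts to A_{p,q} -> A'_{q,p}. It only misses the powers of
   p^(1/2) that are not powers of p^(a/2), which the factor Z[q^(+-1/(2a))]
   supplies. For injectivity on the tensor product, q^(s/(2a)), 0 <= s < |a|,
   is a basis over Z[q^(+-1/2)], and after clearing denominators the
   contributions of distinct s have disjoint exponents modulo a.               *)
Require Import Defs.
From HB Require Import structures.
From mathcomp Require Import all_boot all_order all_algebra.
From mathcomp Require Import finmap boolp.
From mathcomp.multinomials Require Import monalg.

Set Implicit Arguments.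
Unset Strict Implicit.
Unset Printing Implicit Defensive.

Import GRing.Theory Num.Theory.

Local Open Scope fset_scope.
Local Open Scope ring_scope.

(** * Right fractions, and the extension of an embedding to the skew-fields of fractions *)

Lemma mul_right_fractions (R : unitRingType) (u v u' v' s t : R) :
  v \is a GRing.unit -> v' \is a GRing.unit -> t \is a GRing.unit ->
  u' * t = v * s -> u / v * (u' / v') = (u * s) / (v' * t).
Proof.
move=> Uv Uv' Ut E; apply: (mulIr (_ : v' * t \is a GRing.unit)).
  by rewrite unitrMl.
by rewrite mulrVK ?unitrMl // !mulrA mulrVK // -mulrA E mulrA mulrVK.
Qed.

Section FractionExtension.
Variables (T1 T2 : nzRingType) (F1 : skew_fractions T1) (F2 : skew_fractions T2).
Variables (phi : {rmorphism T1 -> T2}) (phi_inj : injective phi).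

Lemma frac_emb_unit (T : nzRingType) (F : skew_fractions T) (v : T) :
  v != 0 -> frac_emb F v \is a GRing.unit.
Proof.
move=> v0; apply/frac_unit; rewrite -(rmorph0 (frac_emb F)).
by apply: contra_neq v0 => /frac_emb_inj.
Qed.

Lemma frac_mul_neq0 (T : nzRingType) (F : skew_fractions T) (u v : T) :
  u != 0 -> v != 0 -> u * v != 0.
Proof.
move=> u0 v0; apply: contraTneq (frac_emb_unit F u0) => uv.
by rewrite -(unitrMl _ (frac_emb_unit F v0)) -rmorphM uv rmorph0 unitr0.
Qed.

(** The right Ore condition is forced by the skew-field: writing [v^-1 u] as a right fraction
    [s t^-1] and clearing denominators gives the relation. *)
Lemma frac_ore (T : nzRingType) (F : skew_fractions T) (u v : T) : v != 0 ->
  exists s t : T, t != 0 /\ u * t = v * s.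
Proof.
move=> v0; have [s [t [t0 E]]] := frac_surj ((frac_emb F v)^-1 * frac_emb F u).
exists s, t; split=> //; apply: (@frac_emb_inj _ F); rewrite !rmorphM.
rewrite -[frac_emb F s](mulrVK (frac_emb_unit F t0)) -E.
by rewrite mulrA mulVKr // frac_emb_unit.
Qed.

(** Induction on [N]: an Ore relation [z * t = v * s] between the new denominator [z] and the old
    one [v] makes [z * t] common. Here [s] is nonzero, so the old fractions expand to
    [(u_i s) (v s)^-1]. *)
Lemma frac_common_denominator (T : nzRingType) (F : skew_fractions T) (N : nat)
    (x : nat -> F) :
  exists (u : nat -> T) (v : T), v != 0 /\
    forall i, (i < N)%N -> x i = frac_emb F (u i) / frac_emb F v.
Proof.
elim: N => [|N [u [v [v0 xE]]]]; first by exists (fun _ => 0), 1; rewrite oner_eq0.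
have [w [z [z0 xN]]] := frac_surj (x N).
have [s [t [t0 E]]] := frac_ore F z v0.
have zt0 : z * t != 0 by exact: (frac_mul_neq0 F).
have s0 : s != 0 by apply: contra_neq zt0; rewrite E => ->; rewrite mulr0.
exists (fun i => if i == N then w * t else u i * s), (z * t); split=> // i.
rewrite ltnS leq_eqVlt => /orP[/eqP->|iN].
  rewrite eqxx xN !rmorphM invrM ?frac_emb_unit // mulrA mulrK //.
  exact: frac_emb_unit.
rewrite ltn_eqF // xE // E !rmorphM invrM ?frac_emb_unit // mulrA mulrK //.
exact: frac_emb_unit.
Qed.

Let eps (u : T1) : F2 := frac_emb F2 (phi u).

Let eps_unit v : v != 0 -> eps v \is a GRing.unit.
Proof.
move=> v0; apply: frac_emb_unit; rewrite -(rmorph0 phi).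
by apply: contra_neq v0 => /phi_inj.
Qed.

Let epsM u v : eps (u * v) = eps u * eps v.
Proof. by rewrite /eps !rmorphM. Qed.

(** An Ore relation between [v] and [v'] turns equality of the fractions into [u * s = u' * t], an
    identity inside [T1], and such identities are preserved by [phi]. *)
Lemma frac_ext_wd (u v u' v' : T1) : v != 0 -> v' != 0 ->
  frac_emb F1 u / frac_emb F1 v = frac_emb F1 u' / frac_emb F1 v' ->
  eps u / eps v = eps u' / eps v'.
Proof.
move=> v0 v'0 E; have [s [t [t0 Est]]] := frac_ore F1 v' v0.
have us : u * s = u' * t.
  apply: (@frac_emb_inj _ F1); rewrite !rmorphM.
  rewrite -[frac_emb F1 u](mulrVK (frac_emb_unit F1 v0)) E -2!mulrA -rmorphM -Est.
  by rewrite rmorphM mulKr ?frac_emb_unit.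
apply: (mulIr (eps_unit v'0)); apply: (mulIr (eps_unit t0)).
rewrite mulrVK ?eps_unit // -epsM -us -[LHS]mulrA -epsM Est !epsM mulrA.
by rewrite mulrVK ?eps_unit.
Qed.

Lemma frac_ext_subproof (x : F1) : exists y : F2, exists u v : T1,
  [/\ v != 0, x = frac_emb F1 u / frac_emb F1 v & y = eps u / eps v].
Proof.
by have [u [v [v0 E]]] := frac_surj x; exists (eps u / eps v), u, v.
Qed.

Definition frac_ext (x : F1) : F2 := sval (cid (frac_ext_subproof x)).

Lemma frac_extE u v : v != 0 ->
  frac_ext (frac_emb F1 u / frac_emb F1 v) = eps u / eps v.
Proof.
move=> v0; rewrite /frac_ext; case: cid => y [u' [v' [v'0 E yE]]] /=.
rewrite yE; exact/esym/frac_ext_wd.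
Qed.

Lemma frac_ext_emb u : frac_ext (frac_emb F1 u) = frac_emb F2 (phi u).
Proof.
have := frac_extE u (oner_neq0 T1).
by rewrite /eps !rmorph1 !divr1.
Qed.

Fact frac_ext_is_zmod_morphism : zmod_morphism frac_ext.
Proof.
move=> x y; have [u [v [v0 E]]] :=
  @frac_common_denominator _ F1 2 (fun i => if i == 0%N then x else y).
have /= -> := E 0%N isT; have /= -> := E 1%N isT.
by rewrite -mulrBl -rmorphB !frac_extE // -mulrBl /eps !rmorphB.
Qed.

Fact frac_ext_is_monoid_morphism : monoid_morphism frac_ext.
Proof.
split=> [|x y]; first by rewrite -(rmorph1 (frac_emb F1)) frac_ext_emb !rmorph1.
have [u [v [v0 ->]]] := frac_surj x; have [u' [v' [v'0 ->]]] := frac_surj y.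
have [s [t [t0 E]]] := frac_ore F1 u' v0.
have v't0 : v' * t != 0 by exact: (frac_mul_neq0 F1).
(* The Ore relation replaces [v^-1 u'] by [s t^-1] in the middle of the product. Its image under
   [phi] does the same in [F2], so both products are computed from the same [s] and [t]. *)
rewrite (@mul_right_fractions _ _ _ _ _ (frac_emb F1 s) (frac_emb F1 t));
  rewrite ?frac_emb_unit -?rmorphM ?E //.
rewrite !frac_extE // !epsM.
by apply/esym/mul_right_fractions; rewrite ?eps_unit -?epsM ?E.
Qed.

Lemma frac_extension :
  exists psi : {rmorphism F1 -> F2},
    forall u, psi (frac_emb F1 u) = frac_emb F2 (phi u).
Proof.
pose zmod := GRing.isZmodMorphism.Build F1 F2 _ frac_ext_is_zmod_morphism.
pose monoid := GRing.isMonoidMorphism.Build F1 F2 _ frac_ext_is_monoid_morphism.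
pose psi : {rmorphism F1 -> F2} := HB.pack frac_ext zmod monoid.
by exists psi; exact: frac_ext_emb.
Qed.

End FractionExtension.

(** Every element but [0] is a unit, and [0^-1 = 0] by convention. Hence negative powers of cluster
    variables can be transported without first proving these variables nonzero. *)
Lemma division_rmorphXz (F1 F2 : unitRingType) (psi : {rmorphism F1 -> F2}) :
  (forall x : F1, x != 0 -> x \is a GRing.unit) ->
  forall (x : F1) (e : int), psi (x ^ e) = psi x ^ e.
Proof.
move=> F1_unit x e.
have psiV y : psi y^-1 = (psi y)^-1.
  have [->|/F1_unit Uy] := eqVneq y 0; first by rewrite invr0 rmorph0 invr0.
  exact: rmorphV.
by case: e => k; rewrite /exprz ?psiV rmorphXn.
Qed.

(** * Morphisms out of twisted monoid algebras *)

Section TwistedHom.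
Variables (R : comNzRingType) (D : twist R) (S : nzRingType).
Variables (sigma : {rmorphism R -> S}) (h : D -> S).
Hypothesis sigma_comm : forall c k, GRing.comm (sigma c) (h k).
Hypothesis h1 : h (tw_one D) = 1.
Hypothesis hM : forall k l, h k * h l = sigma (tw_coef k l) * h (tw_mul k l).

Let eval (x : twalg D) : S := \sum_(k <- msupp x) sigma x@_k * h k.

Let evalw (d : {fset D}) (x : twalg D) : msupp x `<=` d ->
  eval x = \sum_(k <- d) sigma x@_k * h k.
Proof.
move=> le; rewrite /eval (big_fset_incl _ le) //= => k _.
by move/mcoeff_outdom=> ->; rewrite rmorph0 mul0r.
Qed.

Let evalU c k : eval << c *g k >> = sigma c * h k.
Proof. by rewrite (evalw msuppU_le) big_seq_fset1 mcoeffUU. Qed.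

Let eval_is_zmod_morphism : zmod_morphism eval.
Proof.
move=> x y; set d := msupp x `|` msupp y.
rewrite (@evalw d) ?msuppB_le // (@evalw d x) ?fsubsetUl //.
rewrite (@evalw d y) ?fsubsetUr // -sumrB.
by apply/eq_bigr=> k _; rewrite mcoeffB rmorphB mulrBl.
Qed.

Let eval_is_monoid_morphism : monoid_morphism eval.
Proof.
pose zmod := GRing.isZmodMorphism.Build _ _ _ eval_is_zmod_morphism.
pose f : {additive twalg D -> S} := HB.pack eval zmod.
split=> [|x y]; first by rewrite evalU rmorph1 mul1r h1.
have -> : x * y = twmul x y by [].
rewrite twmulE -[LHS]/(f _) raddf_sum [eval x]/eval mulr_suml.
apply/eq_bigr=> k1 _; rewrite raddf_sum mulr_sumr; apply/eq_bigr=> k2 _.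
rewrite /= evalU !rmorphM -mulrA -mulrA -hM !mulrA; congr (_ * _).
by rewrite -!mulrA; congr (_ * _); exact: sigma_comm.
Qed.

(** The universal property used both for quantum tori, with their cocycle, and for the monoid ring
    under the tensor product, where the cocycle is trivial. *)
Lemma twisted_hom :
  exists f : {rmorphism twalg D -> S}, forall c k, f << c *g k >> = sigma c * h k.
Proof.
pose zmod := GRing.isZmodMorphism.Build _ _ _ eval_is_zmod_morphism.
pose monoid := GRing.isMonoidMorphism.Build _ _ _ eval_is_monoid_morphism.
pose f : {rmorphism twalg D -> S} := HB.pack eval zmod monoid.
by exists f; exact: evalU.
Qed.

End TwistedHom.

(** * Expansions in monomials, for twisted algebras and Laurent rings *)

Section TwistedMonomials.
Variables (R : comNzRingType) (D : twist R).

Lemma scale_twmon c (k : D) : c *: twmon k = << c *g k >> :> twalg D.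
Proof.
by rewrite twmonE; apply/malgP=> l; rewrite mcoeffZ !mcoeffU mulrnAr mulr1.
Qed.

Lemma mcoeff_scale_twmon c (k l : D) :
  (c *: twmon k : twalg D)@_l = c *+ (k == l).
Proof. by rewrite scale_twmon mcoeffU. Qed.

Lemma mcoeff_sumZ (I : Type) (s : seq I) (c : I -> R) (f : I -> twalg D) k :
  (\sum_(i <- s) c i *: f i)@_k = \sum_(i <- s) c i * (f i)@_k.
Proof. by rewrite raddf_sum; apply/eq_bigr=> i _; rewrite /= mcoeffZ. Qed.

Lemma twalgE (x : twalg D) : x = \sum_(k <- msupp x) x@_k *: twmon k.
Proof. by rewrite [LHS]monalgE; apply/eq_bigr=> k _; rewrite scale_twmon. Qed.

End TwistedMonomials.

Lemma twmonMz (D : twist int) (k : D) (c : int) :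
  twmon k *~ c = << c *g k >> :> twalg D.
Proof. by rewrite -scale_twmon -scaler_int intz. Qed.

Lemma laurentE (V : zmodType) (x : laurent V) :
  x = \sum_(k <- msupp x) lmon k *~ x@_k.
Proof.
by rewrite [LHS]monalgE; apply/eq_bigr=> k _; rewrite /lmon twmonMz.
Qed.

Lemma laurent_raddf (V : zmodType) (S : zmodType)
    (f : {additive laurent V -> S}) (x : laurent V) :
  f x = \sum_(k <- msupp x) f (lmon k) *~ x@_k.
Proof.
by rewrite {1}[x]laurentE raddf_sum; apply/eq_bigr=> k _; rewrite raddfMz.
Qed.

Lemma laurent_eval_lmon (V : zmodType) (S : nzRingType) (chi : expo V S) v :
  laurent_eval chi (lmon v) = chi v.
Proof. by rewrite /lmon twmonE laurent_evalU. Qed.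

Lemma comm_laurent_eval (V : zmodType) (S : nzRingType) (chi : expo V S) z x :
  (forall v, GRing.comm z (chi v)) -> GRing.comm z (laurent_eval chi x).
Proof.
move=> zchi; rewrite /laurent_eval; apply: (big_ind (GRing.comm z)).
- exact: commr0.
- exact: commrD.
by move=> k _; rewrite /GRing.comm mulrzAr mulrzAl zchi.
Qed.

Lemma laurent_additive_ext (V S : zmodType) (f g : {additive laurent V -> S}) :
  (forall v, f (lmon v) = g (lmon v)) -> f =1 g.
Proof.
move=> fg x; rewrite (laurent_raddf f) (laurent_raddf g).
by apply/eq_bigr=> k _; rewrite fg.
Qed.

(** * Universal property and generation of the tensor product *)

Section TensorHom.
Variables (R A B S : nzRingType).
Variables (f : {rmorphism R -> A}) (g : {rmorphism R -> B}).
Variables (alpha : {rmorphism A -> S}) (beta : {rmorphism B -> S}).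
Hypothesis alpha_beta_comm : forall x y, GRing.comm (alpha x) (beta y).
Hypothesis alpha_f : forall r, alpha (f r) = beta (g r).

(** Since the two images commute, [alpha k.1 * beta k.2] is multiplicative in the pair [k]. It
    extends to the monoid ring, and the extension descends to the quotient. *)
Lemma tensor_hom : exists psi : {rmorphism tensor f g -> S},
  forall x y, psi (tens f g x y) = alpha x * beta y.
Proof.
pose h (k : pair_twist A B) : S := alpha k.1 * beta k.2.
have h1 : h (tw_one _) = 1 by rewrite /h /= !rmorph1 mulr1.
pose sigma : {rmorphism int -> S} := intmul 1.
have sigma_comm c k : GRing.comm (sigma c) (h k) by exact/commr_sym/commr_int.
have hM k l : h k * h l = sigma (tw_coef k l) * h (tw_mul k l).
  rewrite rmorph1 mul1r /h /= !rmorphM -!mulrA; congr (_ * _).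
  by rewrite !mulrA alpha_beta_comm.
have [e eE] := twisted_hom sigma_comm h1 hM.
have e_gen x y : e (pair_gen x y) = alpha x * beta y.
  by rewrite /pair_gen twmonE eE rmorph1 mul1r.
(* [tensor_ideal] is the least ideal containing the relators, so it suffices that the kernel of [e]
   is an ideal containing them. *)
have e_ideal u : u \in tensor_ideal f g -> e u = 0.
  pose ker : {pred pair_ring A B} := fun u => e u == 0.
  move/tensor_idealP=> /(_ ker) kerP; apply/eqP/kerP; last first.
    move=> _ [x x' y|x y y'|x r y]; rewrite unfold_in /ker !rmorphB /= !e_gen.
    - by rewrite rmorphD mulrDl addrAC addrK subrr.
    - by rewrite rmorphD mulrDr addrAC addrK subrr.
    - by rewrite !rmorphM alpha_f mulrA subrr.
  split=> [|x w|x w]; rewrite ?unfold_in /ker.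
  - split=> [|x y]; rewrite !unfold_in /ker ?rmorph0 //.
    by move=> /eqP ex /eqP ey; rewrite rmorphB ex ey subrr.
  - by move/eqP=> ew; rewrite rmorphM ew mulr0.
  - by move/eqP=> ew; rewrite rmorphM ew mul0r.
pose psi0 (x : tensor f g) : S := e (repr x).
have psi0_pi u : psi0 (tensor_pi f g u) = e u.
  apply/eqP; rewrite -subr_eq0 -rmorphB; apply/eqP/e_ideal.
  exact/tensor_piE/tensor_piK.
have psi0_zmod : zmod_morphism psi0.
  move=> x y; rewrite -[x]tensor_piK -[y]tensor_piK.
  have -> : tensor_pi f g (repr x) - tensor_pi f g (repr y) =
      tensor_pi f g (repr x - repr y).
    by apply/esym/(canRL (addrK _)); rewrite -tensor_piD subrK.
  by rewrite !psi0_pi rmorphB.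
have psi0_monoid : monoid_morphism psi0.
  split=> [|x y]; first by rewrite -[1]/(tensor_pi f g 1) psi0_pi rmorph1.
  rewrite -[x]tensor_piK -[y]tensor_piK.
  by rewrite -[_ * _]/(tensor_mul _ _) tensor_mulE !psi0_pi rmorphM.
pose zmod := GRing.isZmodMorphism.Build _ _ _ psi0_zmod.
pose monoid := GRing.isMonoidMorphism.Build _ _ _ psi0_monoid.
pose psi : {rmorphism tensor f g -> S} := HB.pack psi0 zmod monoid.
by exists psi => x y; rewrite /= psi0_pi e_gen.
Qed.

Lemma tensDl x x' y : tens f g (x + x') y = tens f g x y + tens f g x' y.
Proof.
rewrite -tensor_piD; apply/tensor_piE/tensor_idealP=> I _ relI.
by rewrite opprD addrA; apply: relI; exact: TensorDl.
Qed.

Lemma tensDr x y y' : tens f g x (y + y') = tens f g x y + tens f g x y'.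
Proof.
rewrite -tensor_piD; apply/tensor_piE/tensor_idealP=> I _ relI.
by rewrite opprD addrA; apply: relI; exact: TensorDr.
Qed.

Lemma tensZ x r y : tens f g (x * f r) y = tens f g x (g r * y).
Proof.
by apply/tensor_piE/tensor_idealP=> I _ relI; apply: relI; exact: TensorZ.
Qed.

Lemma tens0l y : tens f g 0 y = 0.
Proof. by apply: (addrI (tens f g 0 y)); rewrite -tensDl !addr0. Qed.

Fact tens_is_zmod_morphism x : zmod_morphism (tens f g x).
Proof.
by move=> y y'; apply: (addIr (tens f g x y')); rewrite -tensDr !subrK.
Qed.

HB.instance Definition _ x := GRing.isZmodMorphism.Build B (tensor f g)
  (tens f g x) (tens_is_zmod_morphism x).

Lemma tensBl x x' y : tens f g (x - x') y = tens f g x y - tens f g x' y.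
Proof. by apply: (addIr (tens f g x' y)); rewrite -tensDl !subrK. Qed.

(** The pairs form a basis of the monoid ring over the integers, so pure tensors generate the
    quotient as an additive group. *)
Lemma tensor_span (P : zmodClosed (tensor f g)) :
  (forall x y, tens f g x y \in P) -> forall z, z \in P.
Proof.
move=> Pt z; rewrite -[z]tensor_piK.
pose pi : {additive pair_ring A B -> tensor f g} := \pi_(tensor f g)%qT.
rewrite -[tensor_pi f g _]/(pi _) [repr z]monalgE raddf_sum.
apply: rpred_sum => -[x y] _.
by rewrite -(@twmonMz (pair_twist A B)) raddfMz rpredMz // Pt.
Qed.

End TensorHom.

(** * The twist of the scalars and the independence of residues modulo [a] *)

Section DualScalars.
Variable a : int.

Fact dual_expo0 : pq (a * 0) 0 = 1.
Proof. by rewrite mulr0 pq00. Qed.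

Fact dual_expoD (v w : int * int) :
  pq (a * (v + w).2) (v + w).1 = pq (a * v.2) v.1 * pq (a * w.2) w.1.
Proof. by rewrite pqM mulrDr. Qed.

Definition dual_expo : expo (int * int)%type pq_ring :=
  @Expo (int * int)%type pq_ring (fun v => pq (a * v.2) v.1)
    dual_expo0 dual_expoD.

Definition dual_scal : pq_ring -> pq_ring := laurent_eval dual_expo.

HB.instance Definition _ := GRing.RMorphism.on dual_scal.

Lemma dual_scal_pq i j : dual_scal (pq i j) = pq (a * j) i.
Proof. exact: laurent_eval_lmon. Qed.

Lemma mcoeff_pq (i j i' j' : int) :
  (pq i j)@_((i', j') : int * int) = ((i, j) == (i', j'))%:R.
Proof. by rewrite /pq /lmon twmonE mcoeffU. Qed.

Hypothesis a_neq0 : a != 0.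

(** Uniqueness of division with remainder: for [s] and [t] below [|a|], the equation
    [s + a k = a l + t] forces [s = t] and [k = l]. So the monomials of [c] never collide, and
    different shifts never meet. *)
Lemma mcoeff_dual_scal (s t : nat) (c : pq_ring) (i j : int) :
  (s < `|a|)%N -> (t < `|a|)%N ->
  (pq s 0 * dual_scal c)@_((a * j + t%:Z, i) : int * int) =
    if s == t then c@_((i, j) : int * int) else 0.
Proof.
move=> sa ta.
have eq_exponent (k l : int) :
    (s%:Z + a * k == a * l + t%:Z) = (s == t) && (k == l).
  apply/eqP/andP=> [E|[/eqP-> /eqP->]]; last by rewrite addrC.
  have st : s = t.
    (* As [a] may be negative, remainders are rewritten modulo [|a|], where [s] and [t] are their
       own remainders. *)
    have := congr1 (fun x => (x %% a)%Z) E.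
    rewrite addrC ![a * _]mulrC !modzMDl.
    by rewrite -!(modz_abs _ a) !modz_small // => -[].
  move: E; rewrite st addrC => /addIr /(mulfI a_neq0) ->.
  by rewrite !eqxx.
rewrite /dual_scal (laurent_raddf (laurent_eval _)) mulr_sumr raddf_sum /=.
have mcoeff_term (k : int * int) :
    (pq s 0 * (laurent_eval dual_expo (lmon k) *~ c@_k))
      @_((a * j + t%:Z, i) : int * int) =
    if (s == t) && (k == (i, j)) then c@_k else 0.
  rewrite laurent_eval_lmon mulrzAr pqM add0r.
  rewrite (raddfMz (mcoeff _)) /= mcoeff_pq -mulrzl intz.
  rewrite [in LHS]xpair_eqE eq_exponent -andbA [(_, _) in RHS]surjective_pairing.
  case: k => k l /=; rewrite xpair_eqE [(l == j) && _]andbC.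
  by case: ifP => _; rewrite ?mulr1 ?mulr0.
under eq_bigr do rewrite mcoeff_term.
have [st|st] := eqVneq s t; last by rewrite big1.
have [cij|/mcoeff_outdom cij] := boolP (((i, j) : int * int) \in msupp c).
  rewrite (bigD1_seq _ cij) ?fset_uniq //= eqxx big1 ?addr0 // => k /negPf kij.
  by rewrite kij.
by rewrite big1 // => k _; case: eqP => // ->.
Qed.

(* The exponents of p in the image of [dual_scal] lie in (a/2)Z, so that
   distinct residues s mod a contribute to disjoint sets of monomials. *)
Lemma dual_scal_free (c : nat -> pq_ring) :
  \sum_(s < `|a|) pq s 0 * dual_scal (c s) = 0 ->
  forall t, (t < `|a|)%N -> c t = 0.
Proof.
move=> E t ta; apply/malgP=> -[i j]; rewrite mcoeff0.
have := congr1 (mcoeff ((a * j + t%:Z, i) : int * int)) E.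
rewrite raddf_sum mcoeff0 (bigD1 (Ordinal ta)) //= big1 ?addr0.
  by rewrite mcoeff_dual_scal // eqxx.
by move=> s st; rewrite mcoeff_dual_scal // ifN.
Qed.

End DualScalars.

(** * The twist of the quantum tori *)

Section DualTorus.
Variables (m : nat) (L W : 'M[int]_m) (a : int).

Lemma bform_scale (e f : 'cV[int]_m) : bform (a *: L) e f = a * bform L e f.
Proof. by rewrite /bform -scalemxAr -scalemxAl mxE. Qed.

(** [dual_scal a] carries one cocycle to the other: [p^(e^T W f / 2) q^(e^T L f / 2)] goes to
    [q^(e^T W f / 2) p^(a e^T L f / 2)]. The first argument of [qtorus] is the form for [q], the
    second the form for [p]. *)
Lemma dual_torus_hom :
  exists phi : {rmorphism qtorus L W -> qtorus W (a *: L)},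
    forall c e, phi (c *: torusY L W e) = dual_scal a c *: torusY W (a *: L) e.
Proof.
pose sigma : {rmorphism pq_ring -> qtorus W (a *: L)} :=
  GRing.in_alg (qtorus W (a *: L)) \o dual_scal a.
have sigmaE c x : sigma c * x = dual_scal a c *: x.
  by rewrite /= -scalerAl mul1r.
have sigma_comm c e : GRing.comm (sigma c) (torusY W (a *: L) e).
  by rewrite /GRing.comm sigmaE /= -scalerAr mulr1.
have Y1 : torusY W (a *: L) 0 = 1 by exact: twmon1.
have YM (e f : torus_twist L W) :
    torusY W (a *: L) e * torusY W (a *: L) f =
    sigma (tw_coef e f) * torusY W (a *: L) (tw_mul e f).
  by rewrite sigmaE torusYM bform_scale dual_scal_pq.
have [phi phiE] := @twisted_hom _ (torus_twist L W) _ sigma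
  (torusY W (a *: L)) sigma_comm Y1 YM.
exists phi => c e; rewrite -sigmaE -phiE; congr (phi _).
exact: (@scale_twmon _ (torus_twist L W)).
Qed.

Lemma qtorusE (x : qtorus L W) :
  x = \sum_(e <- msupp x) x@_e *: torusY L W e.
Proof. exact: (@twalgE _ (torus_twist L W)). Qed.

Lemma mcoeff_scale_torusY c e f : (c *: torusY L W e)@_f = c *+ (e == f).
Proof. exact: (@mcoeff_scale_twmon _ (torus_twist L W)). Qed.

End DualTorus.

(** Each [Y^e] is fixed by [phi], which therefore acts coefficient by coefficient. This reduces
    independence in the torus to independence of scalars. *)
Lemma mcoeff_dual_torus (m : nat) (L W : 'M[int]_m) (a : int)
    (phi : {additive qtorus L W -> qtorus W (a *: L)}) :
  (forall c e, phi (c *: torusY L W e) = dual_scal a c *: torusY W (a *: L) e) ->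
  forall x e, (phi x)@_e = dual_scal a x@_e.
Proof.
move=> phiE x e; rewrite {1}[x]qtorusE [x in RHS]qtorusE !raddf_sum /=.
apply: eq_bigr => f _.
rewrite phiE.
apply: etrans (@mcoeff_scale_torusY _ W (a *: L) _ _ _) _.
rewrite -(raddfMn (dual_scal a)).
congr (dual_scal a _).
exact/esym/(@mcoeff_scale_torusY _ L W).
Qed.

(** * Mutation of dual triples and dual seeds *)

Definition dual_triple (a : int) (n r : nat) (T : triple n r) : triple n r :=
  Triple (tB T) (tW T) (a *: tL T).

Lemma mutate_form_scale (n r : nat) (k : 'I_n) (a : int) (B : 'M_(n + r, n))
    (R : 'M_(n + r)) : mutate_form k B (a *: R) = a *: mutate_form k B R.
Proof.
have rowE j : - (a * R (lshift r k) j) +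
      \sum_l Num.max (B l k) 0 * (a *: R) l j =
    a * (- R (lshift r k) j + \sum_l Num.max (B l k) 0 * R l j).
  rewrite mulrDr mulrN mulr_sumr; congr (_ + _).
  by apply: eq_bigr => l _; rewrite mxE mulrCA.
apply/matrixP=> i j; rewrite !mxE.
case: ifP => _; first by case: ifP => _; rewrite ?mulr0 // rowE.
by case: ifP => _ //; rewrite rowE mulrN.
Qed.

Lemma mutate_dual_triple (n r : nat) (a : int) (k : 'I_n) (T : triple n r) :
  mutate_triple k (dual_triple a T) = dual_triple a (mutate_triple k T).
Proof. by rewrite /mutate_triple /dual_triple /= mutate_form_scale. Qed.

Section DualSeeds.
Variables (n r : nat) (B : 'M[int]_(n + r, n)) (L W : 'M[int]_(n + r)) (a : int).
Variables (F : skew_fractions (qtorus L W)).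
Variables (F' : skew_fractions (qtorus W (a *: L))).
Variable phi : {rmorphism qtorus L W -> qtorus W (a *: L)}.
Hypothesis phiE :
  forall c e, phi (c *: torusY L W e) = dual_scal a c *: torusY W (a *: L) e.
Variable Phi : {rmorphism F -> F'}.
Hypothesis PhiE : forall u, Phi (frac_emb F u) = frac_emb F' (phi u).

Lemma phi_torusY e : phi (torusY L W e) = torusY W (a *: L) e.
Proof. by rewrite -[torusY L W e]scale1r phiE rmorph1 scale1r. Qed.

Lemma Phi_scal c : Phi (scal F c) = scal F' (dual_scal a c).
Proof.
rewrite /scal PhiE; congr (frac_emb F' _).
(* Writing [1] as [Y^0] brings [c%:A] into the form to which [phiE] applies. *)
have Y1 L1 W1 : 1 = @torusY (n + r) L1 W1 0 by exact/esym/twmon1.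
by rewrite (Y1 L W) phiE -Y1.
Qed.

(** The invariant carried along the tree: besides matching variables it keeps the triples dual, so
    that the next exchange relations match as well. *)
Definition dual_seeds (s : seed F) (s' : seed F') : Prop :=
  seed_triple s' = dual_triple a (seed_triple s) /\
  forall i, Phi (seed_var s i) = seed_var s' i.

(** The ordering exponents are linear in the forms, so swapping the forms and scaling [L] by [a]
    changes the normalising scalar exactly as [dual_scal a] does. *)
Lemma dual_seed_monomial s s' e : dual_seeds s s' ->
  Phi (seed_monomial s e) = seed_monomial s' e.
Proof.
case=> tE vE.
have ordE (R : 'M[int]_(n + r)) :
    \sum_(i : 'I_(n + r)) \sum_(j : 'I_(n + r) | (i < j)%N)
      e i 0 * e j 0 * (a *: R) i j =
    a * \sum_(i : 'I_(n + r)) \sum_(j : 'I_(n + r) | (i < j)%N)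
      e i 0 * e j 0 * R i j.
  rewrite mulr_sumr; apply: eq_bigr => i _; rewrite mulr_sumr.
  by apply: eq_bigr => j _; rewrite mxE mulrCA.
rewrite /seed_monomial rmorphM rmorph_prod tE /= ordE Phi_scal dual_scal_pq mulrN.
congr (_ * _).
by apply: eq_bigr => i _; rewrite (division_rmorphXz _ (@frac_unit _ F)) vE.
Qed.

Lemma dual_mutate_seed s s' k : dual_seeds s s' ->
  dual_seeds (mutate_seed s k) (mutate_seed s' k).
Proof.
move=> ss'; case: (ss') => tE vE; split.
  by rewrite /= tE mutate_dual_triple.
move=> i /=; case: ifP => // _.
by rewrite rmorphD !(dual_seed_monomial _ ss') tE.
Qed.

Lemma dual_seed_at t : dual_seeds (seed_at B F t) (seed_at B F' t).
Proof.
rewrite /seed_at; have : dual_seeds (initial_seed B F) (initial_seed B F').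
  by split=> // i /=; rewrite PhiE phi_torusY.
elim: (val t) (initial_seed _ _) (initial_seed _ _) => // k ks IHks s s' ss'.
exact/IHks/dual_mutate_seed.
Qed.

(** The preimage of the second subring under [Phi] is a subring, and it contains the generators
    because [Phi] sends each to a generator of the same kind. *)
Lemma Phi_second_quantization x :
  x \in gen_subring (sq_generator B (F := F)) ->
  Phi x \in gen_subring (sq_generator B (F := F')).
Proof.
pose P : {pred F} :=
  fun x => `[< Phi x \in gen_subring (sq_generator B (F := F')) >].
move/gen_subringP=> /(_ P) xP; suff /asboolP: x \in P by [].
apply: xP => [|_ [c|j|j|t i]].
- split=> [|y z /asboolP Py /asboolP Pz|y z /asboolP Py /asboolP Pz];
    apply/asboolP.
  + by rewrite rmorph1 rpred1.
  + by rewrite rmorphB rpredB.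
  + by rewrite rmorphM rpredM.
- by apply/asboolP; rewrite Phi_scal; apply/mem_gen_subring; exact: GenScal.
- apply/asboolP; rewrite PhiE phi_torusY.
  by apply/mem_gen_subring; exact: GenFrozen.
- apply/asboolP; rewrite PhiE phi_torusY.
  by apply/mem_gen_subring; exact: GenFrozenV.
apply/asboolP; have [_ ->] := dual_seed_at t.
by apply/mem_gen_subring; exact: GenCluster.
Qed.

End DualSeeds.

(** * Scalars as central elements of the second quantization *)

Section SecondQuantizationScalars.
Variables (n r : nat) (B : 'M[int]_(n + r, n)) (L W : 'M[int]_(n + r)).
Variable F : skew_fractions (qtorus L W).

Fact sq_scal_is_zmod_morphism : zmod_morphism (sq_scal B F).
Proof. by move=> c d; apply: val_inj; rewrite /= /scal scalerBl rmorphB. Qed.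

HB.instance Definition _ := GRing.isZmodMorphism.Build pq_ring
  (second_quantization B F) (sq_scal B F) sq_scal_is_zmod_morphism.

Fact p_expo0 : sq_scal B F (pq 0 0) = 1.
Proof. by rewrite pq00 sq_scal1. Qed.

Fact p_expoD v w :
  sq_scal B F (pq (v + w) 0) = sq_scal B F (pq v 0) * sq_scal B F (pq w 0).
Proof. by rewrite -sq_scalM pqM. Qed.

(** In the target algebra this evaluates the right-hand tensor factor: its variable [q^(1/(2a))]
    goes to [p^(1/2)]. *)
Definition p_expo : expo int (second_quantization B F) := Expo p_expo0 p_expoD.

Lemma p_expo_central x y : GRing.comm x (laurent_eval p_expo y).
Proof. by apply: comm_laurent_eval => k; exact/esym/sq_scal_central. Qed.

End SecondQuantizationScalars.

(** * Independence over the twisted image, and the isomorphism *)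

Section DualIsomorphism.
Variables (n r : nat) (B : 'M[int]_(n + r, n)) (L W : 'M[int]_(n + r)) (a : int).
Variables (F : skew_fractions (qtorus L W)).
Variables (F' : skew_fractions (qtorus W (a *: L))).
Hypothesis a_neq0 : a != 0.
Variable phi : {rmorphism qtorus L W -> qtorus W (a *: L)}.
Hypothesis phiE :
  forall c e, phi (c *: torusY L W e) = dual_scal a c *: torusY W (a *: L) e.

Lemma dual_torus_free (u : nat -> qtorus L W) :
  \sum_(s < `|a|) pq s 0 *: phi (u s) = 0 ->
  forall t, (t < `|a|)%N -> u t = 0.
Proof.
move=> E t ta; apply/malgP=> e; rewrite mcoeff0.
apply: (dual_scal_free a_neq0 (c := fun s => (u s)@_e)) ta.
have E0 := congr1 (mcoeff e) E; rewrite mcoeff0 in E0; rewrite -[RHS]E0.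
apply: etrans (esym (@mcoeff_sumZ _ (torus_twist W (a *: L)) _ _ _ _ _)).
by apply: eq_bigr => s _; congr (_ * _); apply/esym/mcoeff_dual_torus.
Qed.

(** This is independence with only the residue [0] contributing, a residue available because
    [|a| > 0]. *)
Lemma dual_torus_inj : injective phi.
Proof.
apply/raddf_inj=> x phix.
have a_gt0 : (0 < `|a|)%N by rewrite absz_gt0.
apply: (dual_torus_free (u := fun s => if s == 0%N then x else 0) _ a_gt0).
by rewrite big1 // => s _; case: ifP => _; rewrite ?phix ?rmorph0 scaler0.
Qed.

Variable Phi : {rmorphism F -> F'}.
Hypothesis PhiE : forall u, Phi (frac_emb F u) = frac_emb F' (phi u).

(** Over a common denominator [v], the central scalars [p^(s/2)] move past [(phi v)^-1], and the
    relation becomes one between numerators in the torus. *)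
Lemma dual_fractions_free (x : nat -> F) :
  \sum_(s < `|a|) Phi (x s) * scal F' (pq s 0) = 0 ->
  forall t, (t < `|a|)%N -> x t = 0.
Proof.
have [u [v [v0 xE]]] := frac_common_denominator `|a| x.
move=> E t ta; rewrite xE // (_ : u t = 0) ?rmorph0 ?mul0r //.
apply: dual_torus_free ta; apply: (@frac_emb_inj _ F'); rewrite rmorph0.
have phiv0 : phi v != 0.
  by rewrite -(rmorph0 phi); apply: contra_neq v0 => /dual_torus_inj.
apply: (mulIr (_ : (frac_emb F' (phi v))^-1 \is a GRing.unit)).
  by rewrite unitrV frac_emb_unit.
rewrite mul0r -[RHS]E rmorph_sum mulr_suml; apply: eq_bigr => s _.
rewrite xE // rmorphM rmorphV ?frac_emb_unit // !PhiE.
have -> : pq s 0 *: phi (u s) = phi (u s) * (pq s 0)%:A.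
  by rewrite -scalerAr mulr1.
rewrite rmorphM -!mulrA; congr (_ * _).
(* The scalar commutes with [(phi v)^-1]: multiplying by [phi v] on the left reduces this to
   commutation with [phi v] itself. *)
apply: (mulrI (frac_emb_unit F' phiv0)); rewrite mulVKr ?frac_emb_unit //.
rewrite /scal mulrA -rmorphM -scalerAr mulr1.
have -> : pq s 0 *: phi v = (pq s 0)%:A * phi v by rewrite -scalerAl mul1r.
by rewrite rmorphM mulrK ?frac_emb_unit.
Qed.

Let sq_Phi (x : second_quantization B F) : second_quantization B F' :=
  Sub (Phi (val x)) (Phi_second_quantization phiE PhiE (valP x)).

Lemma dual_isomorphism :
  exists psi : {rmorphism sq_extension B F a -> second_quantization B F'},
    bijective psi /\ forall x k,
      val (psi (sq_tens B F a x (lmon k))) = Phi (val x) * scal F' (pq k 0).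
Proof.
have alpha_zmod : zmod_morphism sq_Phi.
  by move=> x y; apply: val_inj; rewrite /= !rmorphB.
have alpha_monoid : monoid_morphism sq_Phi.
  by split=> [|x y]; apply: val_inj; rewrite /= ?rmorph1 ?rmorphM.
pose zmod := GRing.isZmodMorphism.Build _ _ _ alpha_zmod.
pose monoid := GRing.isMonoidMorphism.Build _ _ _ alpha_monoid.
pose alpha : {rmorphism second_quantization B F -> second_quantization B F'} :=
  HB.pack sq_Phi zmod monoid.
pose beta : {rmorphism laurent int -> second_quantization B F'} :=
  laurent_eval (p_expo B F').
have betaE k : beta (lmon k) = sq_scal B F' (pq k 0) by exact: laurent_eval_lmon.
have alpha_beta_comm x y : GRing.comm (alpha x) (beta y) by exact: p_expo_central.
have alpha_scal c : alpha (sq_scal B F c) = sq_scal B F' (dual_scal a c).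
  by apply: val_inj; rewrite /= (Phi_scal phiE PhiE).
(* Balancedness: on the left [q^(1/2)] is twisted to [p^(a/2)], and on the right it is the [a]-th
   power of [q^(1/(2a))], which goes to [p^(1/2)]. *)
have alpha_q y : alpha (laurent_eval (q_expo B F) y) =
    beta (laurent_eval (root_expo a) y).
  pose A1 := alpha \o laurent_eval (q_expo B F).
  pose A2 := beta \o laurent_eval (root_expo a).
  apply: (@laurent_additive_ext _ _ A1 A2) y => k.
  rewrite /A1 /A2 /comp /= !laurent_eval_lmon /=.
  by rewrite -[sq_Phi _]/(alpha _) alpha_scal dual_scal_pq.
have [psi psiE] := tensor_hom alpha_beta_comm alpha_q.
have psi_lmon x k : val (psi (sq_tens B F a x (lmon k))) =
    Phi (val x) * scal F' (pq k 0).
  by rewrite psiE betaE.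
exists psi; split=> //.
have psi_inj : injective psi.
  (* Injectivity first needs a normal form: every tensor is a sum of [c_s] tensored with
     [q^(s/(2a))], for [0 <= s < |a|]. Independence of fractions then kills each [c_s]. *)
  pose P0 : {pred sq_extension B F a} := fun z =>
    `[< exists c : nat -> second_quantization B F,
          z = \sum_(s < `|a|) sq_tens B F a (c s) (lmon s%:Z) >].
  have P_zmod : zmod_closed P0.
    split=> [|y z /asboolP[c ->] /asboolP[d ->]]; apply/asboolP.
      by exists (fun _ => 0); rewrite big1 // => s _; exact: tens0l.
    exists (fun s => c s - d s); rewrite -sumrB.
    by apply: eq_bigr => s _; rewrite [RHS]tensBl.
  pose P : zmodClosed (sq_extension B F a) :=
    HB.pack P0 (GRing.isZmodClosed.Build _ P0 P_zmod).
  have in_P z : z \in P.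
    apply: tensor_span => x y.
    rewrite (laurent_raddf (tens _ _ x)); apply: rpred_sum => k _.
    apply: rpredMz; apply/asboolP.
    (* Dividing [k] by [a] leaves the remainder [t] on the right; the quotient crosses the tensor
       sign as a power of [q^(1/2)]. *)
    have [t ta kE] : exists2 t : nat, (t < `|a|)%N & k = a * (k %/ a)%Z + t%:Z.
      have := ltz_mod k a_neq0; have := modz_ge0 k a_neq0.
      case E: (k %% a)%Z => [t|//] _ ta; exists t; first by rewrite -ltz_nat.
      by rewrite mulrC -E -divz_eq.
    exists (fun s => if s == t then x * sq_scal B F (pq 0 (k %/ a)%Z) else 0).
    rewrite (bigD1 (Ordinal ta)) //= eqxx big1 ?addr0 => [|s st]; last first.
      by rewrite ifN //; exact: tens0l.
    rewrite {1}kE lmonD.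
    have -> : lmon (a * (k %/ a)%Z) = laurent_eval (root_expo a) (lmon (k %/ a)%Z).
      by rewrite laurent_eval_lmon.
    by rewrite -tensZ /= laurent_eval_lmon.
  apply: raddf_inj => z psiz; have /asboolP[c zE] := in_P z.
  rewrite zE big1 // => s _; rewrite (_ : c s = 0); first exact: tens0l.
  apply: val_inj; apply: (dual_fractions_free (x := fun s => val (c s))) => //.
  have := congr1 val psiz; rewrite zE !raddf_sum /= => psi0.
  by apply: etrans psi0; apply: eq_bigr => t _; rewrite -psi_lmon.
(* The scalar [p^(i/2) q^(j/2)] of the target comes from [p^(j/2)] tensored with [q^(i/(2a))]. *)
have psi_scal c : exists z, psi z = sq_scal B F' c.
  have psi_term (k : int * int) (z : int) :
      psi (sq_tens B F a (sq_scal B F (pq k.2 0)) (lmon k.1) *~ z) =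
      sq_scal B F' (lmon k) *~ z.
    rewrite raddfMz; congr (_ *~ z); apply: etrans (psiE _ _) _.
    rewrite betaE alpha_scal dual_scal_pq -sq_scalM pqM mulr0.
    by rewrite add0r addr0; case: k.
  exists (\sum_(k <- msupp (c : laurent (int * int)%type))
    sq_tens B F a (sq_scal B F (pq k.2 0)) (lmon k.1) *~ c@_k).
  rewrite (laurent_raddf (sq_scal B F')) raddf_sum.
  by apply: eq_bigr => k _; exact: psi_term.
have psi_surj y : exists z, psi z = y.
  (* The image of [psi] is a subring, so surjectivity is checked on generators only. *)
  pose P : {pred F'} := fun y => `[< exists z, val (psi z) = y >].
  have : val y \in P.
    have /gen_subringP := valP y; apply=> [|_ [c|j|j|t i]].
    - split=> [|u v /asboolP[x <-] /asboolP[z <-]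
               |u v /asboolP[x <-] /asboolP[z <-]]; apply/asboolP.
      + by exists 1; rewrite rmorph1.
      + by exists (x - z); rewrite rmorphB.
      + by exists (x * z); rewrite rmorphM.
    - by have [z zE] := psi_scal c; apply/asboolP; exists z; rewrite zE.
    - apply/asboolP; exists (sq_tens B F a (sq_frozen B F j) (lmon 0)).
      by rewrite psi_lmon /= PhiE (phi_torusY phiE) pq00 /scal scale1r rmorph1 mulr1.
    - apply/asboolP.
      exists (sq_tens B F a (gen_elt (GenFrozenV B F j)) (lmon 0)).
      by rewrite psi_lmon /= PhiE (phi_torusY phiE) pq00 /scal scale1r rmorph1 mulr1.
    apply/asboolP; exists (sq_tens B F a (sq_cluster B F t i) (lmon 0)).
    rewrite psi_lmon /= pq00 /scal scale1r rmorph1 mulr1.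
    by have [_ ->] := dual_seed_at B phiE PhiE t.
  by move/asboolP=> [z zE]; exists z; apply: val_inj.
exists (fun y => sval (cid (psi_surj y))) => [z|y]; last by case: cid.
by apply: psi_inj; case: cid.
Qed.

End DualIsomorphism.

Theorem theorem3p8 (n r : nat) (B : 'M[int]_(n + r, n)) (L W : 'M[int]_(n + r))
    (a : int)
    (F : skew_fractions (qtorus L W)) (F' : skew_fractions (qtorus W (a *: L))) :
  compatible_triple B L W ->
  compatible_pair B W ->
  a != 0 ->
  compatible_triple B W (a *: L) ->
  exists psi : {rmorphism sq_extension B F a -> second_quantization B F'},
    [/\ bijective psi,
        forall (t : tree_vertex n) (i : 'I_n),
          psi (sq_tens B F a (sq_cluster B F t i) 1) = sq_cluster B F' t i,
        forall j : 'I_r,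
          psi (sq_tens B F a (sq_frozen B F j) 1) = sq_frozen B F' j,
        forall i j : int,
          psi (sq_tens B F a (sq_scal B F (pq i j)) 1)
            = sq_scal B F' (pq (a * j) i)
      & forall k : int,
          psi (sq_tens B F a 1 (lmon k)) = sq_scal B F' (pq k 0)].
Proof.
move=> _ _ a_neq0 _.
have [phi phiE] := dual_torus_hom L W a.
have [Phi PhiE] := frac_extension F F' (dual_torus_inj a_neq0 phiE).
have [psi [psi_bij psiE]] := dual_isomorphism B a_neq0 phiE PhiE.
have psi1 x : val (psi (sq_tens B F a x 1)) = Phi (val x).
  by rewrite -lmon0 psiE pq00 /scal scale1r rmorph1 mulr1.
exists psi; split=> // [t i|j|i j|k]; apply: val_inj.
- by rewrite psi1; have [_ ->] := dual_seed_at B phiE PhiE t.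
- by rewrite psi1 /= PhiE (phi_torusY phiE).
- by rewrite psi1 /= (Phi_scal phiE PhiE) dual_scal_pq.
- by rewrite psiE rmorph1 mul1r.
Qed.
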